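(* Let $k$ be a field (of any characteristic), let $\Delta$ be an oriented pseudo-manifold over $k$ of dimension $n-1$ with vertices $v_1,\ldots,v_N$ and maximal simplices $\sigma_1,\ldots,\sigma_M$, and let $K=k(a_{i,j})_{1\le i\le n,\,0\le j\le N}$. Let $l=x_1+\cdots+x_N$ and let $m$ be an integer with $0\le m\le n/2$. Let $\Pi_i$ be the boundary of the cone $\{v_0\}*\sigma_i$, and let $W_\Delta$, $W_{\Pi_i}$, $c_{\Pi_i}$, $\operatorname{ev}_{\Pi_i}$ be as defined in the context. Then the quadratic form $Q_l(g)=W_\Delta(l^{\,n-2m}g^2)$ on $K[x_1,\ldots,x_N]_m$ is given by \[ Q_l(g)=\sum_{i=1}^M W_{\Pi_i}(l^{\,n-2m}g^2)=\sum_{i=1}^M\frac{1}{c_{\Pi_i}}\big[\operatorname{ev}_{\Pi_i}(l)\big]^{n-2m}\big[\operatorname{ev}_{\Pi_i}(g)\big]^2 . \]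
   Context: Pseudo-manifolds. A pseudo-manifold of dimension $n-1$ is a (finite, abstract) pure simplicial complex $\Delta$ of dimension $n-1$ such that every $(n-2)$-simplex lies in exactly two $(n-1)$-simplices and the geometric realization of $\Delta$ remains connected after removing its $(n-3)$-skeleton. An orientation of a simplex is an ordering of its vertices up to even permutations; the orientation $v_{j_1},\ldots,v_{j_n}$ induces the orientation $v_{j_2},\ldots,v_{j_n}$ on its facet. An orientation of $\Delta$ is a choice of orientation of each $(n-1)$-simplex such that for every $(n-2)$-simplex the orientations induced from the two $(n-1)$-simplices containing it are opposite. Over a field of characteristic $2$ every pseudo-manifold counts as oriented, with an arbitrary ordering of the vertices of each maximal simplex. Mixed volume. Let $\Delta$ be an oriented pseudo-manifold of dimension $n-1$. For a maximal simplex $\sigma$ with positively ordered vertices $v_{j_1},\ldots,v_{j_n}$ put $\det\sigma=\det(a_{p,j_q})_{1\le p,q\le n}$. Let $\phi_\sigma:K[t_1,\ldots,t_n]\to K[x_{j_1},\ldots,x_{j_n}]$ be the isomorphism $t_p\mapsto\sum_{q}a_{p,j_q}x_{j_q}$. For a polynomial $f$ in the variables $x_j$ let $f_\sigma\in K[t_1,\ldots,t_n]$ be obtained by setting $x_j=0$ for all $v_j\notin\sigma$ and applying $\phi_\sigma^{-1}$; let $\chi_\sigma=(\det\sigma)\,\phi_\sigma^{-1}(x_{j_1}\cdots x_{j_n})$. For $f$ homogeneous of degree $n$ the sum $W_\Delta(f)=\sum_\sigma f_\sigma/\chi_\sigma$ over all maximal simplices $\sigma$ is an element of $K$; this defines the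 linear function (mixed volume) $W_\Delta:K[x_1,\ldots,x_N]_n\to K$. The subscript on a polynomial ring denotes the homogeneous part of that degree. The spheres $\Pi_i$. Let $v_0$ be a new vertex, with associated variables $x_0$ and $a_{1,0},\ldots,a_{n,0}$. For a maximal simplex $\sigma_i$ of $\Delta$ with positively ordered vertices $v_{j_1},\ldots,v_{j_n}$, let $\Pi_i$ be the boundary of the $n$-simplex $\{v_0\}*\sigma_i$, a simplicial $(n-1)$-sphere, oriented so that $\sigma_i$ has the same orientation in $\Pi_i$ as in $\Delta$. The function $W_{\Pi_i}$ is the mixed volume of $\Pi_i$ (defined with the parameters $a_{p,0},a_{p,j_1},\ldots,a_{p,j_n}$), regarded as a function on $K[x_1,\ldots,x_N]_n$ by first setting $x_j=0$ for all $v_j\notin\Pi_i$. Let $A_i$ be the $n\times(n+1)$ matrix whose columns, numbered $0,1,\ldots,n$, are the columns $(a_{p,0})_p,(a_{p,j_1})_p,\ldots,(a_{p,j_n})_p$, and let $X_q^{(i)}$ be $(-1)^q$ times the determinant of $A_i$ with its $q$-th column removed. Set $c_{\Pi_i}=X_0^{(i)}X_1^{(i)}\cdots X_n^{(i)}\in K$, and let $\operatorname{ev}_{\Pi_i}:K[x_1,\ldots,x_N]\to K$ be the $K$-algebra homomorphism with $x_{j_q}\mapsto X_q^{(i)}$ for $q=1,\ldots,n$ and $x_j\mapsto0$ if $v_j\notin\Pi_i$. *)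

(* Defs.v *)
From mathcomp Require Import all_boot all_order all_algebra all_fingroup.
From mathcomp Require Import Rstruct Rstruct_topology.
From mathcomp Require classical_sets.
From mathcomp Require Import matrix_topology.
From mathcomp Require connected.
From mathcomp.multinomials Require Import mpoly.

Set Implicit Arguments.
Unset Strict Implicit.
Unset Printing Implicit Defensive.

Import GRing.Theory Num.Theory.
Local Open Scope ring_scope.

(* A simplex is its set of vertices; the empty set is the simplex of
   dimension -1. *)

Section Complexes.
Variable r : nat.
Implicit Type D : {set {set 'I_r}}.

Definition simplicial_complex D : Prop :=
  [/\ set0 \in D,
      forall v : 'I_r, [set v] \in D
    & forall s t : {set 'I_r}, s \in D -> t \subset s -> t \in D].

Definition facets D : {set {set 'I_r}} :=
  [set s | maxset (fun t : {set 'I_r} => t \in D) s].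

(* The faces of D with at most c vertices: the skeleton of dimension c - 1. *)
Definition skeleton (c : nat) D : {set {set 'I_r}} :=
  [set s in D | (#|s| <= c)%N].

(* Points of the geometric realization are given by their barycentric coordinates. *)
Definition realization D : classical_sets.set 'rV[Rdefinitions.R]_r :=
  fun p => [/\ forall i, 0 <= p ord0 i,
               \sum_i p ord0 i = 1
             & [set i | p ord0 i != 0] \in D].

(* The connectedness condition is not imposed in dimension 0, where it would
   exclude the 0-sphere: two points, sharing the (-1)-simplex set0. *)
Definition pseudo_manifold (n : nat) D : Prop :=
  [/\ simplicial_complex D,
      forall s, s \in facets D -> #|s| = n,
      forall t, t \in D -> #|t|.+1 = n ->
        #|[set s in facets D | t \subset s]| = 2%N
    & (1 < n)%N ->
        connected.connected
          (classical_sets.setD (realization D)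
                               (realization (skeleton (n - 2) D)))].

Definition ordering_of n (w : n.-tuple 'I_r) (s : {set 'I_r}) : Prop :=
  uniq w /\ [set x in w] = s.

Definition same_orientation n (w w' : n.-tuple 'I_r) : Prop :=
  exists2 p : 'S_n, ~~ odd_perm p & w' = [tuple tnth w (p q) | q < n].

(* The orientation of the facet s of D is represented by the ordering o s.
   The orientation induced by s on t is represented by the orderings w of t
   such that v :: w is a positive ordering of s, where v is the vertex of s
   that is not in t. *)
Definition induced_orientation n (o : {set 'I_r} -> n.-tuple 'I_r)
    (s t : {set 'I_r}) (w : seq 'I_r) : Prop :=
  [/\ uniq w, [set x in w] = t
    & exists (v : 'I_r) (u : n.-tuple 'I_r),
        same_orientation (o s) u /\ val u = v :: w].

(* Equivalently, the two sets of induced orderings are the two classes modulo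
   even permutations. Comparing them this way also gives the right answer when
   t is a single vertex, which has one ordering but two orientations: exactly
   one of s and s' then induces that ordering. *)
Definition opposite_on n (o : {set 'I_r} -> n.-tuple 'I_r)
    (s s' t : {set 'I_r}) : Prop :=
  forall w : seq 'I_r, uniq w -> [set x in w] = t ->
    induced_orientation o s t w <-> ~ induced_orientation o s' t w.

Definition is_orientation (k : fieldType) n D
    (o : {set 'I_r} -> n.-tuple 'I_r) : Prop :=
  (forall s, s \in facets D -> ordering_of (o s) s) /\
  (2%N \in [pchar k] \/
   forall t, t \in D -> #|t|.+1 = n ->
   forall s s', s \in facets D -> s' \in facets D -> s != s' ->
     t \subset s -> t \subset s' -> opposite_on o s s' t).

End Complexes.

Arguments is_orientation {r} k {n} D o.

Lemma comp_mpolyA (R : comNzRingType) a b c (f : {mpoly R[a]})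
    (u : a.-tuple {mpoly R[b]}) (v : b.-tuple {mpoly R[c]}) :
  (f \mPo u) \mPo v = f \mPo [tuple tnth u i \mPo v | i < a].
Proof.
rewrite (comp_mpolyE f u) raddf_sum comp_mpolyE; apply: eq_bigr => m _ /=.
rewrite comp_mpolyZ rmorph_prod /=; congr (_ *: _).
by apply: eq_bigr => i _; rewrite rmorphXn tnth_mktuple.
Qed.

(* A p j is the parameter a_{p,j}; w lists the positively ordered vertices of
   a maximal simplex. *)

Section MixedVolume.
Variables (K : fieldType) (n r : nat) (A : 'M[K]_(n, r)).

Definition restrict (S : {set 'I_r}) (f : {mpoly K[r]}) : {mpoly K[r]} :=
  f \mPo [tuple (if j \in S then 'X_j else 0) | j < r].

Section Simplex.
Variable w : n.-tuple 'I_r.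

Definition simplex_mx : 'M[K]_n := \matrix_(p, q) A p (tnth w q).

Definition phi (f : {mpoly K[n]}) : {mpoly K[r]} :=
  f \mPo [tuple \sum_(q < n) A p (tnth w q) *: 'X_(tnth w q) | p < n].

(* The inverse of phi on K[x_j, j in w], extended to all polynomials by
   sending the other variables to 0; see phiK and phi_invK. *)
Definition phi_inv (f : {mpoly K[r]}) : {mpoly K[n]} :=
  f \mPo [tuple (if [pick q | tnth w q == j] is Some q
                 then \sum_(p < n) invmx simplex_mx q p *: 'X_p else 0)
         | j < r].

Lemma phi_invX (w_uniq : uniq w) q :
  phi_inv 'X_(tnth w q) = \sum_(p < n) invmx simplex_mx q p *: 'X_p.
Proof.
rewrite /phi_inv comp_mpolyXU -tnth_nth tnth_mktuple.
case: pickP => [q' /eqP e|/(_ q)]; last by rewrite eqxx.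
by have -> : q' = q by apply/eqP; rewrite -(tuple_uniqP _ w_uniq _ _ e).
Qed.

Lemma phiK (w_uniq : uniq w) (A_w : simplex_mx \in unitmx) :
  cancel phi phi_inv.
Proof.
rewrite /phi /phi_inv => f; rewrite comp_mpolyA -[RHS]comp_mpoly_id.
congr (_ \mPo _); apply: eq_from_tnth => p; rewrite !tnth_mktuple raddf_sum.
transitivity (\sum_(p' < n) (simplex_mx *m invmx simplex_mx) p p' *: 'X_p'
              : {mpoly K[n]}).
  under [RHS]eq_bigr => p' _ do rewrite mxE scaler_suml.
  rewrite exchange_big /=; apply: eq_bigr => q _.
  rewrite comp_mpolyZ [_ \mPo _]phi_invX // scaler_sumr.
  by apply: eq_bigr => p' _; rewrite scalerA mxE.
rewrite mulmxV // (bigD1 p) //= big1 => [|p' /negPf ne_p'p].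
  by rewrite mxE eqxx scale1r addr0.
by rewrite mxE eq_sym ne_p'p scale0r.
Qed.

Lemma phi_invK (w_uniq : uniq w) (A_w : simplex_mx \in unitmx) f :
  phi (phi_inv f) = restrict [set x in w] f.
Proof.
rewrite /phi /phi_inv comp_mpolyA; congr (_ \mPo _).
apply: eq_from_tnth => j; rewrite !tnth_mktuple inE.
case: pickP => [q /eqP <-|w'j]; last first.
  rewrite raddf0; case: ifP => // /tnthP[q e_j].
  by have := w'j q; rewrite e_j eqxx.
rewrite mem_tnth raddf_sum.
transitivity (\sum_(q' < n) (invmx simplex_mx *m simplex_mx) q q'
                *: 'X_(tnth w q') : {mpoly K[r]}).
  under [RHS]eq_bigr => q' _ do rewrite mxE scaler_suml.
  rewrite exchange_big /=; apply: eq_bigr => p _.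
  rewrite comp_mpolyZ comp_mpolyXU -tnth_nth tnth_mktuple scaler_sumr.
  by apply: eq_bigr => q' _; rewrite scalerA [simplex_mx p q']mxE.
rewrite mulVmx // (bigD1 q) //= big1 => [|q' /negPf ne_q'q].
  by rewrite mxE eqxx scale1r addr0.
by rewrite mxE eq_sym ne_q'q scale0r.
Qed.

Definition local_poly (f : {mpoly K[r]}) : {mpoly K[n]} :=
  phi_inv (restrict [set x in w] f).

Definition chi : {mpoly K[n]} :=
  \det simplex_mx *: phi_inv (\prod_(q < n) 'X_(tnth w q)).

End Simplex.

Definition mixed_volume_frac (D : {set {set 'I_r}})
    (o : {set 'I_r} -> n.-tuple 'I_r) (f : {mpoly K[r]}) :
    {fraction {mpoly K[n]}} :=
  \sum_(s in facets D)
     FracField.tofrac (local_poly (o s) f) / FracField.tofrac (chi (o s)).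

(* The element c of K that is equal to mixed_volume_frac (0 if there is
   none). *)
Definition mixed_volume D o f : K :=
  classical_sets.xget 0
    (fun c : K => mixed_volume_frac D o f =
                 FracField.tofrac (c%:MP : {mpoly K[n]})).

End MixedVolume.

(* The vertices v_1, ..., v_N of the pseudo-manifold are the elements of 'I_N.
   When the vertex v_0 is added, the index set becomes 'I_N.+1, with v_0 as
   ord0 and j : 'I_N as lift ord0 j. *)

Section Cone.
Variables (K : fieldType) (n N : nat) (A : 'M[K]_(n, N.+1)).

Definition old_columns : 'M[K]_(n, N) := col' ord0 A.

Definition cone (s : {set 'I_N}) : {set 'I_N.+1} :=
  ord0 |: [set lift ord0 j | j in s].

Definition Pi (s : {set 'I_N}) : {set {set 'I_N.+1}} :=
  [set t : {set 'I_N.+1} | t \proper cone s].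

Definition lift_ordering (w : n.-tuple 'I_N) : n.-tuple 'I_N.+1 :=
  [tuple lift ord0 (tnth w q) | q < n].

Definition extend (f : {mpoly K[N]}) : {mpoly K[N.+1]} :=
  f \mPo [tuple 'X_(lift ord0 j) | j < N].

Definition mixed_volume_Pi (s : {set 'I_N})
    (o : {set 'I_N.+1} -> n.-tuple 'I_N.+1) (f : {mpoly K[N]}) : K :=
  mixed_volume A (Pi s) o (restrict (cone s) (extend f)).

Section Evaluation.
Variable w : n.-tuple 'I_N.

Definition cone_mx : 'M[K]_(n, n.+1) :=
  \matrix_(p, q) A p (if unlift ord0 q is Some q'
                      then lift ord0 (tnth w q') else ord0).

Definition coneX (q : 'I_n.+1) : K := (-1) ^+ q * \det (col' q cone_mx).

Definition c_Pi : K := \prod_(q < n.+1) coneX q.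

Definition ev_Pi (f : {mpoly K[N]}) : K :=
  f.@[fun j => if [pick q | tnth w q == j] is Some q
               then coneX (lift ord0 q) else 0].

End Evaluation.

Definition ell : {mpoly K[N]} := \sum_(j < N) 'X_j.

Definition Q_ell (D : {set {set 'I_N}}) (o : {set 'I_N} -> n.-tuple 'I_N)
    (m : nat) (g : {mpoly K[N]}) : K :=
  mixed_volume old_columns D o (ell ^+ (n - 2 * m) * g ^+ 2).

End Cone.

(* k(a_{p,j}) for 1 <= p <= n and 0 <= j <= N: the variables are indexed by
   mxvec_index p j. *)

Definition param_field (k : fieldType) (n N : nat) : fieldType :=
  {fraction {mpoly k[n * N.+1]}}.

Definition param_mx (k : fieldType) (n N : nat) :
    'M[param_field k n N]_(n, N.+1) :=
  \matrix_(p, j) FracField.tofrac ('X_(mxvec_index p j) : {mpoly k[n * N.+1]}).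

(* Main.v *)
Require Import Defs.
From mathcomp Require Import all_boot all_order all_algebra all_fingroup.
From mathcomp.multinomials Require Import mpoly.

Set Implicit Arguments.
Unset Strict Implicit.
Unset Printing Implicit Defensive.

Import GRing.Theory.
Local Open Scope ring_scope.

(** The idea is to compare chains: adding the boundaries of the cones
    {v_0} * sigma_i, the facets through v_0 cancel in pairs, and the sum of the
    spheres Pi_i is Delta itself.

    A maximal simplex sigma contributes f_sigma / chi_sigma to a mixed volume.
    This contribution (simplex_term) depends on the ordering of sigma only
    through the sign of det sigma (simplex_term_sign), so that orientations can
    be compared through determinants: if two adjacent maximal simplices induce
    opposite orientations on the common face, with vertices rest, then
      det (o s) * det (v' :: rest) = - det (o s') * det (v :: rest)
    (opposite_det). In characteristic 2 this holds because all the signs are 1.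
    For a codimension-one face t of Delta, common to sigma and sigma', the
    equation in Delta and the two equations in the spheres Pi give opposite
    determinants, hence opposite contributions, to the two copies of the facet
    {v_0} * t (cone_ridge_cancel). As every t lies in exactly two maximal simplices, the
    contributions of the facets through v_0 sum to 0 (sum_ridges_eq0).

    It remains to compute W on the boundary of one n-simplex with vertex set C
    (sum_boundary_terms). The numbers X_v are, by Cramer, the coefficients of
    the linear relation between the n + 1 columns of parameters; opposite_det
    shows that X_v is the determinant of the oriented facet C - v. The linear system
    sum_j a_j x_j = t has a line of solutions x^0 + y X, and the substitution
    f |-> f_sigma for the facet C - v evaluates f at the point of that line
    where the coordinate v vanishes, say y = y_v. Hence the numerator of the
    contribution of C - v is h(y_v), where h(y) = f(x^0 + y X) is a polynomial
    of degree at most n whose coefficient in degree n is f(X), and the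
    denominator is (prod X) * prod_(j != v) (y_v - y_j). By Lagrange
    interpolation (sum_newton_quotients) the sum of the quotients
    h(y_v) / prod_(j != v) (y_v - y_j) is that top coefficient, so
    W(f) = f(X) / prod X. In particular the sum is a constant, and so is the
    fraction that defines W_Delta, being a sum of such sums. *)

(** * Interpolation, and polynomials restricted to a line *)

(** The polynomial h is its own Lagrange interpolant at the points y i, and the
    Lagrange basis polynomials have degree #|S| - 1; compare the coefficients
    in that degree. *)
Lemma sum_newton_quotients (F : fieldType) (I : finType) (S : {set I})
    (y : I -> F) (h : {poly F}) :
    {in S &, injective y} -> (size h <= #|S|)%N ->
  \sum_(i in S) h.[y i] / \prod_(j in S :\ i) (y i - y j) = h`_#|S|.-1.
Proof.
move=> y_inj size_h.
have nz i : i \in S -> \prod_(j in S :\ i) (y i - y j) != 0.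
  move=> Si; apply/prodf_neq0 => j /setD1P[ne_ji Sj].
  by rewrite subr_eq0; apply: contra_neq ne_ji => /y_inj ->.
pose b i := \prod_(j in S :\ i) ('X - (y j)%:P).
have size_b i : i \in S -> size (b i) = #|S|.
  move=> Si; rewrite /b -big_enum size_prod_XsubC -cardE.
  by rewrite [in RHS](cardsD1 i) Si.
pose g := \sum_(i in S) (h.[y i] / \prod_(j in S :\ i) (y i - y j)) *: b i.
suff hg : h = g.
  rewrite [in RHS]hg coef_sum; apply: eq_bigr => i Si.
  have /monicP : b i \is monic by apply: monic_prod_XsubC.
  by rewrite coefZ /lead_coef size_b // => ->; rewrite mulr1.
apply/eqP; rewrite -subr_eq0; apply/eqP.
apply: (@roots_geq_poly_eq0 _ (h - g) [seq y i | i <- enum S]).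
- apply/allP => _ /mapP[i Si ->]; rewrite mem_enum in Si.
  rewrite /root hornerD hornerN subr_eq0 horner_sum.
  rewrite [X in _ == X](bigD1 i) //= [X in _ + X]big1 => [|j /andP[Sj ne_ji]].
    rewrite addr0 hornerZ horner_prod.
    by under [X in _ * X]eq_bigr do rewrite hornerXsubC; rewrite divfK ?nz.
  rewrite hornerZ (_ : (b j).[y i] = 0) ?mulr0 // horner_prod (bigD1 i) /=.
    by rewrite hornerXsubC subrr mul0r.
  by rewrite !inE Si eq_sym ne_ji.
- rewrite map_inj_in_uniq ?enum_uniq // => i j; rewrite !mem_enum.
  exact: y_inj.
rewrite size_map -cardE (leq_trans (size_polyD _ _)) // geq_max size_h.
rewrite size_polyN.
apply: (leq_trans (size_sum _ _ _)); apply/bigmax_leqP => i Si.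
by rewrite (leq_trans (size_scale_leq _ _)) ?size_b.
Qed.

Lemma coefM_top (R : nzRingType) (p q : {poly R}) (a b : nat) :
    (size p <= a.+1)%N -> (size q <= b.+1)%N ->
  (size (p * q)%R <= (a + b).+1)%N /\ (p * q)`_(a + b) = p`_a * q`_b.
Proof.
move=> size_p size_q; split.
  apply: leq_trans (size_polyMleq p q) _.
  have := leq_add size_p size_q; rewrite addSn addnS.
  by case: (size p + size q)%N => [|d].
have lt_a : (a < (a + b).+1)%N by rewrite ltnS leq_addr.
rewrite coefM (bigD1 (Ordinal lt_a)) //= addKn big1 ?addr0 // => j ne_ja.
have [lt_ja|le_aj] := ltnP j a.
  rewrite [q`__]nth_default ?mulr0 // (leq_trans size_q) //.
  by rewrite ltn_subRL ltn_add2r.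
rewrite nth_default ?mul0r // (leq_trans size_p) // ltn_neqAle le_aj andbT.
by rewrite eq_sym.
Qed.

Lemma rmorph_mmap (r : nat) (R S T : nzRingType) (iota : R -> S)
    (u : {rmorphism S -> T}) (v : 'I_r -> S) (f : {mpoly R[r]}) :
  u (mmap iota v f) = mmap (u \o iota) (u \o v) f.
Proof.
rewrite rmorph_sum; apply: eq_bigr => mu _; rewrite rmorphM rmorph_prod.
by congr (_ * _); apply: eq_bigr => j _; rewrite rmorphXn.
Qed.

Lemma eq_mmap (r : nat) (R S : nzRingType) (iota iota' : R -> S)
    (v v' : 'I_r -> S) (f : {mpoly R[r]}) :
  iota =1 iota' -> v =1 v' -> mmap iota v f = mmap iota' v' f.
Proof.
move=> eq_iota eq_v; apply: eq_bigr => mu _.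
by rewrite eq_iota; congr (_ * _); apply: eq_bigr => j _; rewrite eq_v.
Qed.

Section Line.
Variables (r : nat) (R : nzRingType) (F : fieldType).
Variables (iota : {rmorphism R -> F}) (a b : 'I_r -> F).

(** The polynomial y |-> f(a + y b), with iota applied to the coefficients of
    f. *)
Definition on_line (f : {mpoly R[r]}) : {poly F} :=
  mmap (polyC \o iota) (fun j => (a j)%:P + b j *: 'X) f.

Lemma horner_on_line f y :
  (on_line f).[y] = mmap iota (fun j => a j + b j * y) f.
Proof.
rewrite -[LHS]/(horner_eval y _) rmorph_mmap; apply: eq_mmap => [c|j] /=.
  by rewrite /horner_eval hornerC.
by rewrite /horner_eval !hornerE.
Qed.

(** Each monomial of degree d becomes a product of d factors a_j + b_j y. *)
Lemma on_line_homog d f : f \is d.-homog ->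
  (size (on_line f) <= d.+1)%N /\ (on_line f)`_d = mmap iota b f.
Proof.
move=> /dhomogP f_homog.
have mono (mu : 'X_{1.. r}) (q := \prod_j ((a j)%:P + b j *: 'X) ^+ mu j) :
    (size q <= (mdeg mu).+1)%N /\ q`_(mdeg mu) = \prod_j b j ^+ mu j.
  rewrite {}/q mdegE.
  apply: (big_ind3 (fun (p : {poly F}) (e : nat) (c : F) =>
            (size p <= e.+1)%N /\ p`_e = c)).
  - by rewrite size_poly1 coef1.
  - by move=> p e c p' e' c' [sp <-] [sp' <-]; apply: coefM_top.
  move=> j _; elim: (mu j) => [|e [sIH cIH]].
    by rewrite !expr0 size_poly1 coef1.
  have size_lin : (size ((a j)%:P + b j *: 'X)%R <= 2)%N.
    rewrite (leq_trans (size_polyD _ _)) // geq_max.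
    rewrite (leq_trans (size_polyC_leq1 _)) //.
    by rewrite (leq_trans (size_scale_leq _ _)) ?size_polyX.
  have [sM cM] := coefM_top size_lin sIH.
  rewrite !exprS -add1n; split; first exact: sM.
  by rewrite cM cIH coefD coefC coefZ coefX add0r mulr1.
split.
  apply: (leq_trans (size_sum _ _ _)); apply/bigmax_leqP_seq => mu f_mu _.
  rewrite /= mul_polyC (leq_trans (size_scale_leq _ _)) //.
  by rewrite -(f_homog mu f_mu); case: (mono mu).
rewrite coef_sum; apply: eq_big_seq => mu f_mu.
by rewrite /= coefCM -(f_homog mu f_mu); case: (mono mu) => _ ->.
Qed.

End Line.

(** * The linear forms that define the contribution of a simplex *)

Section SimplexForms.
Variables (K : fieldType) (n r : nat) (A : 'M[K]_(n, r)).
Implicit Types (w : n.-tuple 'I_r) (L : 'I_r -> {mpoly K[n]}).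

Definition simplex_form w (j : 'I_r) : {mpoly K[n]} :=
  phi_inv A w 'X_j.

Lemma simplex_form_out w j : j \notin w -> simplex_form w j = 0.
Proof.
rewrite /simplex_form /phi_inv comp_mpolyXU -tnth_nth tnth_mktuple => w'j.
by case: pickP => // q /eqP e; rewrite -e mem_tnth in w'j.
Qed.

Lemma sum_uniq_tuple (V : zmodType) w (F : 'I_r -> V) :
  uniq w -> \sum_(q < n) F (tnth w q) = \sum_(j in w) F j.
Proof. by move=> w_uniq; rewrite -big_uniq // big_tuple. Qed.

(** Together with the vanishing off w, this system determines the forms: it says
    that phi inverts the substitution by them. *)
Lemma sum_simplex_form w p : uniq w -> simplex_mx A w \in unitmx ->
  \sum_j A p j *: simplex_form w j = 'X_p.
Proof.
move=> w_uniq A_w; rewrite (bigID (mem w)) /= [X in _ + X]big1 ?addr0.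
  rewrite -sum_uniq_tuple //.
  transitivity (\sum_(p' < n) (simplex_mx A w *m invmx (simplex_mx A w)) p p'
                  *: 'X_p' : {mpoly K[n]}).
    under [RHS]eq_bigr => p' _ do rewrite mxE scaler_suml.
    rewrite exchange_big /=; apply: eq_bigr => q _.
    rewrite /simplex_form phi_invX // scaler_sumr.
    by apply: eq_bigr => p' _; rewrite scalerA mxE.
  rewrite mulmxV // (bigD1 p) //= big1 => [|p' /negPf ne_p'p].
    by rewrite mxE eqxx scale1r addr0.
  by rewrite mxE eq_sym ne_p'p scale0r.
by move=> j w'j; rewrite simplex_form_out ?scaler0.
Qed.

Lemma simplex_form_unique w L : uniq w -> simplex_mx A w \in unitmx ->
    (forall j, j \notin w -> L j = 0) ->
    (forall p, \sum_j A p j *: L j = 'X_p) ->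
  L =1 simplex_form w.
Proof.
move=> w_uniq A_w L0 LX j.
have [/tnthP[q ->]|w'j] := boolP (j \in w); last first.
  by rewrite L0 // simplex_form_out.
rewrite /simplex_form phi_invX //; under eq_bigr => p _ do rewrite -LX.
under eq_bigr => p _.
  rewrite (bigID (mem w)) /= [X in _ + X]big1 ?addr0 => [|i w'i]; last first.
    by rewrite L0 ?scaler0.
  rewrite -sum_uniq_tuple // scaler_sumr.
  over.
rewrite exchange_big /=.
transitivity (\sum_(q' < n) (invmx (simplex_mx A w) *m simplex_mx A w) q q'
                *: L (tnth w q')).
  rewrite mulVmx // (bigD1 q) //= big1 => [|q' /negPf ne_q'q].
    by rewrite mxE eqxx scale1r addr0.
  by rewrite mxE eq_sym ne_q'q scale0r.
apply: eq_bigr => q' _; rewrite mxE scaler_suml.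
by apply: eq_bigr => p _; rewrite scalerA [simplex_mx _ _ _ _]mxE.
Qed.

Lemma simplex_form_neq0 w j : uniq w -> simplex_mx A w \in unitmx ->
  j \in w -> simplex_form w j != 0.
Proof.
move=> w_uniq A_w /tnthP[q ->]; rewrite /simplex_form phi_invX //.
apply/eqP => form0.
have row0 p : invmx (simplex_mx A w) q p = 0.
  have := congr1 (mcoeff U_(p)) form0; rewrite raddf_sum mcoeff0 /=.
  rewrite (bigD1 p) //= big1 => [|p' ne_p'p].
    by rewrite addr0 mcoeffZ mcoeffX eqxx mulr1.
  rewrite mcoeffZ mcoeffX (_ : (U_(p') == U_(p))%MM = false) ?mulr0 //.
  by apply: contraNF ne_p'p => /eqP/mnmP/(_ p); rewrite !mnm1E eqxx; case: eqP.
have := mulVmx A_w; move/matrixP/(_ q q); rewrite !mxE eqxx big1.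
  by move/esym/eqP; rewrite oner_eq0.
by move=> p _; rewrite row0 mul0r.
Qed.

(** As the forms vanish off w, no restriction of f is necessary first. *)
Lemma local_polyE w f :
  local_poly A w f = mmap (@mpolyC _ _) (simplex_form w) f.
Proof.
rewrite /local_poly /phi_inv /restrict comp_mpolyA.
apply: eq_mmap => // j; rewrite !tnth_mktuple inE.
by case: ifP => // /negbT w'j; rewrite comp_mpoly0 simplex_form_out.
Qed.

Lemma chiE w : uniq w ->
  chi A w = \det (simplex_mx A w) *: \prod_(j in w) simplex_form w j.
Proof.
move=> w_uniq; rewrite /chi /phi_inv rmorph_prod -big_uniq // [in RHS]big_tuple.
by [].
Qed.

Definition simplex_term w f : {fraction {mpoly K[n]}} :=
  FracField.tofrac (local_poly A w f) / FracField.tofrac (chi A w).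

End SimplexForms.

(** * The mixed volume of the boundary of a simplex *)

Section BoundaryOfSimplex.
Variables (K : fieldType) (n r : nat) (A : 'M[K]_(n, r)).
Variables (C : {set 'I_r}) (X : 'I_r -> K) (u : 'I_r -> n.-tuple 'I_r).
Hypothesis u_ord : forall v, v \in C -> ordering_of (u v) (C :\ v).
Hypothesis det_u : forall v, v \in C -> \det (simplex_mx A (u v)) = X v.
Hypothesis X_neq0 : forall v, v \in C -> X v != 0.
Hypothesis X_out : forall v, v \notin C -> X v = 0.
Hypothesis kerX : forall p, \sum_j A p j * X j = 0.

Let u_uniq v : v \in C -> uniq (u v).
Proof. by case/u_ord. Qed.

Let mem_u v j : v \in C -> (j \in u v) = (j \in C :\ v).
Proof. by case/u_ord => _ <-; rewrite inE. Qed.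

Let u_unit v : v \in C -> simplex_mx A (u v) \in unitmx.
Proof. by move=> Cv; rewrite unitmxE det_u // unitfE X_neq0. Qed.

(** The right-hand side still solves the system sum_j a_j x_j = t, because X is
    in the kernel of A, and its coordinate v is 0; the solution with these
    properties is unique. *)
Lemma simplex_form_translate v0 v j : v0 \in C -> v \in C ->
  simplex_form A (u v) j =
    simplex_form A (u v0) j - (X j / X v) *: simplex_form A (u v0) v.
Proof.
move=> Cv0 Cv; symmetry; move: j.
apply: simplex_form_unique => [||j|p]; [exact: u_uniq|exact: u_unit| |].
  rewrite mem_u // !inE negb_and negbK => /predU1P[->|C'j].
    by rewrite divff ?X_neq0 // scale1r subrr.
  rewrite X_out // mul0r scale0r subr0 simplex_form_out // mem_u //.
  by rewrite !inE negb_and C'j orbT.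
under eq_bigr => j _ do rewrite scalerBr scalerA mulrA.
rewrite sumrB sum_simplex_form ?u_uniq ?u_unit // -scaler_suml -mulr_suml.
by rewrite kerX mul0r scale0r subr0.
Qed.

(** Along the line of solutions with parameter y, the coordinate j is
    X_j (y - y_j); so the facet C - v, where y = y_v, has as its chi the product
    of all X_j and of the differences y_v - y_j. The sum over v is then the sum
    of Newton quotients of a polynomial with top coefficient f(X). The y_v are
    distinct because the forms of a simplex are nonzero. *)
Lemma sum_boundary_terms v0 (f : {mpoly K[r]}) :
    v0 \in C -> f \is n.-homog ->
  \sum_(v in C) simplex_term A (u v) f =
    FracField.tofrac ((f.@[X] / \prod_(v in C) X v)%:MP : {mpoly K[n]}).
Proof.
move=> Cv0 f_homog.
pose iota : {rmorphism K -> {fraction {mpoly K[n]}}} :=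
  (@FracField.tofrac _) \o (@mpolyC n K).
pose x j := FracField.tofrac (simplex_form A (u v0) j).
(* The parameter of the point of the line where the coordinate v vanishes. *)
pose y v := - (x v / iota (X v)).
have tofracZ c (p : {mpoly K[n]}) :
    FracField.tofrac (c *: p) = iota c * FracField.tofrac p.
  by rewrite -mul_mpolyC tofracM.
have card_C : #|C| = n.+1.
  have [uniq_u0 set_u0] := u_ord Cv0.
  by rewrite (cardsD1 v0) Cv0 -set_u0 cardsE (card_uniqP uniq_u0) size_tuple.
have iota_neq0 v : v \in C -> iota (X v) != 0.
  by move=> Cv; rewrite fmorph_eq0 X_neq0.
have formE v j : v \in C ->
    FracField.tofrac (simplex_form A (u v) j) = x j + iota (X j) * y v.
  move=> Cv; rewrite (simplex_form_translate _ Cv0 Cv) tofracB tofracZ.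
  by rewrite rmorphM fmorphV /y mulrN mulrAC -mulrA.
have form_factor v j : v \in C -> j \in C ->
    FracField.tofrac (simplex_form A (u v) j) = iota (X j) * (y v - y j).
  move=> Cv Cj; rewrite formE // mulrBr addrC; congr (_ + _).
  by rewrite /y mulrN opprK mulrCA divff ?mulr1 ?iota_neq0.
have y_inj : {in C &, injective y}.
  move=> v j Cv Cj eq_y; apply/eqP; apply: contraT => ne_vj.
  have := form_factor v j Cv Cj; rewrite eq_y subrr mulr0 => /eqP.
  rewrite tofrac_eq0 (negPf (simplex_form_neq0 _ _ _)) ?u_uniq ?u_unit //.
  by rewrite mem_u // !inE eq_sym ne_vj.
have [size_h coef_h] := on_line_homog iota x (iota \o X) f_homog.
have := sum_newton_quotients y_inj (h := on_line iota x (iota \o X) f).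
rewrite card_C => /(_ size_h) /= sum_h.
transitivity ((on_line iota x (iota \o X) f)`_n / iota (\prod_(v in C) X v)).
  rewrite -sum_h mulr_suml; apply: eq_bigr => v Cv.
  rewrite /simplex_term local_polyE rmorph_mmap chiE ?u_uniq // -mulrA.
  congr (_ * _).
    rewrite horner_on_line; apply: eq_mmap => // j.
    by rewrite -formE.
  rewrite -invfM; congr (_^-1).
  rewrite tofracZ det_u //.
  rewrite [in RHS]rmorph_prod (bigD1 v Cv) /= mulrCA; congr (_ * _).
  rewrite rmorph_prod mulrC /=.
  under [in RHS]eq_bigl => j do rewrite andbC -in_setD1.
  rewrite -big_split; apply: eq_big => [j|j]; first by rewrite mem_u.
  by rewrite mem_u // => /setD1P[_ Cj]; rewrite /= form_factor.
rewrite coef_h -[FracField.tofrac _%:MP]/(iota _) rmorphM fmorphV.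
by congr (_ / _); rewrite rmorph_mmap.
Qed.

End BoundaryOfSimplex.

(** * Orientations through determinants *)

Section Orientation.
Variables (K : fieldType) (n r : nat) (A : 'M[K]_(n, r)).
Implicit Types (u w : n.-tuple 'I_r) (s t : {set 'I_r}).

Lemma ordering_perm_eq u u' s :
  ordering_of u s -> ordering_of u' s -> perm_eq u' u.
Proof.
move=> [uniq_u set_u] [uniq_u' set_u']; apply: uniq_perm => // j.
by have /setP/(_ j) := etrans set_u (esym set_u'); rewrite !inE => ->.
Qed.

Lemma same_orientation_ordering u u' s :
  ordering_of u s -> same_orientation u u' -> ordering_of u' s.
Proof.
move=> [uniq_u set_u] [p _ def_u'].
have perm_u : perm_eq u' u by apply/tuple_permP; exists p; rewrite def_u'.
split; first by rewrite (perm_uniq perm_u).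
by rewrite -set_u; apply/setP => j; rewrite !inE (perm_mem perm_u).
Qed.

Lemma det_simplex_perm u (p : 'S_n) :
  \det (simplex_mx A [tuple tnth u (p q) | q < n]) =
    (-1) ^+ p * \det (simplex_mx A u).
Proof.
have ->: simplex_mx A [tuple tnth u (p q) | q < n] = col_perm p (simplex_mx A u).
  by apply/matrixP => i q; rewrite !mxE tnth_mktuple.
by rewrite col_permE det_mulmx det_perm odd_permV mulrC.
Qed.

Lemma det_same_orientation u u' : same_orientation u u' ->
  \det (simplex_mx A u') = \det (simplex_mx A u).
Proof. by case=> p /negPf even_p ->; rewrite det_simplex_perm even_p mul1r. Qed.

(** The bit b is the parity of the unique permutation that relates u and u'.
    In characteristic 2 the determinants alone would not determine it. *)
Lemma orientation_sign u u' s : ordering_of u s -> ordering_of u' s ->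
  exists b : bool, (same_orientation u u' <-> ~~ b)
    /\ \det (simplex_mx A u) = (-1) ^+ b * \det (simplex_mx A u').
Proof.
move=> u_ord u'_ord.
have /tuple_permP[p /val_inj def_u'] := ordering_perm_eq u_ord u'_ord.
exists (odd_perm p); split; last first.
  by rewrite def_u' det_simplex_perm mulrA -expr2 sqrr_sign mul1r.
split=> [[p' even_p' def_u'2]|even_p]; last by exists p.
suff ->: p = p' by [].
apply/permP => q; have [uniq_u _] := u_ord.
apply: (tuple_uniqP _ uniq_u).
have := congr1 (fun w => tnth w q) (etrans (esym def_u') def_u'2).
by rewrite !tnth_mktuple.
Qed.

(** The vertex of s that is not in rest is forced, so the existential
    quantifiers in the induced orientation have only one candidate. *)
Lemma induced_orientationE (o : {set 'I_r} -> n.-tuple 'I_r) s v rest u :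
    ordering_of (o s) s -> ordering_of u s -> val u = v :: rest ->
  induced_orientation o s [set x in rest] rest <-> same_orientation (o s) u.
Proof.
move=> os_ord [uniq_u set_u] def_u; rewrite def_u /= in uniq_u.
have [v_rest uniq_rest] := andP uniq_u.
split=> [[_ _ [v1 [u1 [so_u1 def_u1]]]]|so_u]; last by split=> //; exists v, u.
suff ->: u = u1 by [].
have [uniq_u1 set_u1] := same_orientation_ordering os_ord so_u1.
apply: val_inj; rewrite def_u def_u1; congr (_ :: _).
have : v1 \in [set x in u] by rewrite set_u -set_u1 inE memtE def_u1 mem_head.
rewrite inE memtE def_u in_cons => /predU1P[//|v1_rest].
by rewrite def_u1 /= v1_rest in uniq_u1.
Qed.

(** In characteristic 2 signs do not matter. Otherwise exactly one of the
    orderings u, u' is positively oriented, so the signs that relate them to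
    o s and o s' are opposite. The conclusion is a relation
    between four determinants, in which no sign has to be chosen. *)
Lemma opposite_det (o : {set 'I_r} -> n.-tuple 'I_r) s s' v v' rest u u' :
    ordering_of (o s) s -> ordering_of (o s') s' ->
    ordering_of u s -> ordering_of u' s' ->
    val u = v :: rest -> val u' = v' :: rest ->
    (1 = -1 :> K) \/ opposite_on o s s' [set x in rest] ->
  \det (simplex_mx A (o s)) * \det (simplex_mx A u') =
    - (\det (simplex_mx A (o s')) * \det (simplex_mx A u)).
Proof.
move=> os_ord os'_ord u_ord u'_ord def_u def_u' opp.
have [b [so_b ->]] := orientation_sign os_ord u_ord.
have [b' [so_b' ->]] := orientation_sign os'_ord u'_ord.
suff ->: (-1) ^+ b = - (-1) ^+ b' :> K.
  by rewrite !mulNr -!mulrA; congr (- (_ * _)); rewrite mulrC.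
case: opp => [char2|]; first by case: (b); case: (b'); rewrite ?opprK -?char2.
have uniq_rest : uniq rest by case: u_ord; rewrite def_u => /andP[].
move=> /(_ rest uniq_rest erefl).
have ind := induced_orientationE os_ord u_ord def_u.
have ind' := induced_orientationE os'_ord u'_ord def_u'.
case: b b' so_b so_b' => [] [] /= so_b so_b' opp; rewrite ?opprK //; exfalso;
  tauto.
Qed.

End Orientation.

(** * Dependence of a contribution on the ordering *)

Section TermDependence.
Variables (K : fieldType) (n r : nat) (A : 'M[K]_(n, r)).
Implicit Types (u w : n.-tuple 'I_r).

Lemma simplex_term_sign u u' s (b : bool) f :
    ordering_of u s -> ordering_of u' s -> simplex_mx A u \in unitmx ->
    \det (simplex_mx A u') = (-1) ^+ b * \det (simplex_mx A u) ->
  simplex_term A u' f = (-1) ^+ b * simplex_term A u f.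
Proof.
move=> u_ord u'_ord A_u det_u'.
have [uniq_u _] := u_ord; have [uniq_u' _] := u'_ord.
have mem_u := perm_mem (ordering_perm_eq u_ord u'_ord).
have A_u' : simplex_mx A u' \in unitmx.
  by rewrite unitmxE det_u' unitrM unitrX ?unitrN1.
have eq_form : simplex_form A u =1 simplex_form A u'.
  apply: simplex_form_unique => // [j|p]; last exact: sum_simplex_form.
  by rewrite mem_u; apply: simplex_form_out.
rewrite /simplex_term !local_polyE !chiE // det_u' -scalerA.
rewrite (eq_bigl _ _ mem_u); under [in LHS]eq_bigr => j _ do rewrite -eq_form.
rewrite (eq_mmap _ (frefl _) (fsym eq_form)) -mul_mpolyC tofracM invfM.
rewrite mulrCA; congr (_ * _); rewrite !rmorphXn /= mpolyCN mpolyC1 tofracN.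
by rewrite tofrac1 -exprVn invrN1.
Qed.

Lemma simplex_term_same_orientation u u' s f :
    ordering_of u s -> simplex_mx A u \in unitmx -> same_orientation u u' ->
  simplex_term A u' f = simplex_term A u f.
Proof.
move=> u_ord A_u so_uu'.
rewrite (simplex_term_sign (b := false) f u_ord) ?mul1r //.
  exact: same_orientation_ordering so_uu'.
exact: det_same_orientation.
Qed.

Lemma simplex_term_restrict w (S : {set 'I_r}) f :
  {subset w <= S} -> simplex_term A w (restrict S f) = simplex_term A w f.
Proof.
move=> sub_wS; rewrite /simplex_term; congr (FracField.tofrac _ / _).
rewrite /local_poly; congr (phi_inv _ _ _); rewrite /restrict comp_mpolyA.
congr (_ \mPo _); apply: eq_from_tnth => j; rewrite !tnth_mktuple inE.
case: ifP => [Sj|S'j]; first by rewrite comp_mpolyXU -tnth_nth tnth_mktuple inE.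
by rewrite raddf0; case: ifP => // /sub_wS; rewrite S'j.
Qed.

End TermDependence.

(** * Minors of a matrix with one column more than rows *)

(** The sum is the expansion along the first row of the determinant obtained by
    writing row p on top of M, which has two equal rows. *)
Lemma signed_minors_kernel (R : comNzRingType) n (M : 'M[R]_(n, n.+1)) p :
  \sum_q M p q * ((-1) ^+ q * \det (col' q M)) = 0.
Proof.
pose B := \matrix_(i < n.+1, q < n.+1) M (odflt p (unlift ord0 i)) q.
have detB0 : \det B = 0.
  apply: (@determinant_alternate _ _ B ord0 (lift ord0 p)) => // q.
  by rewrite !mxE unlift_none liftK.
rewrite -[RHS]detB0 (expand_det_row _ ord0); apply: eq_bigr => q _.
rewrite !mxE unlift_none /cofactor; congr (_ * (_ * \det _)).
by apply/matrixP => i j; rewrite !mxE liftK.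
Qed.

(** Expand both determinants along the column that is moved. *)
Lemma det_move_col (R : comPzRingType) n (M M' : 'M[R]_n.+1) q :
    (forall p, M' p ord0 = M p q) ->
    (forall p j, M' p (lift ord0 j) = M p (lift q j)) ->
  \det M' = (-1) ^+ q * \det M.
Proof.
move=> col0 colS; rewrite (expand_det_col _ ord0) (expand_det_col M q).
rewrite big_distrr; apply: eq_bigr => p _; rewrite col0 [RHS]mulrCA; congr (_ * _).
rewrite /cofactor addn0 exprD mulrA mulrCA -expr2 sqrr_sign mulr1.
by congr (_ * \det _); apply/matrixP => i j; rewrite !mxE.
Qed.

(** * Cones, and the boundary of a cone *)

Lemma setD1_inj (T : finType) (S : {set T}) :
  {in S &, injective (fun v => S :\ v)}.
Proof.
move=> i j Si _ /= eq_D1; have : i \notin S :\ j by rewrite -eq_D1 setD11.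
by rewrite in_setD1 Si andbT negbK => /eqP.
Qed.

Section ConeBoundary.
Variables (K : fieldType) (n N : nat) (A : 'M[K]_(n, N.+1)).
Implicit Types (w : n.-tuple 'I_N) (s t : {set 'I_N}) (f : {mpoly K[N]}).

Definition lift_set s : {set 'I_N.+1} := [set lift ord0 j | j in s].

Lemma ord0_lift_set s : ord0 \notin lift_set s.
Proof. by apply/imsetP => -[j _ /eqP]; rewrite (negPf (neq_lift _ _)). Qed.

Lemma mem_lift_set s j : (lift ord0 j \in lift_set s) = (j \in s).
Proof. by rewrite mem_imset //; apply: lift_inj. Qed.

Lemma mem_cone s j : (lift ord0 j \in cone s) = (j \in s).
Proof. by rewrite in_setU1 eq_sym (negPf (neq_lift _ _)) mem_lift_set. Qed.

Lemma big_cone (R : Type) (idx : R) (op : Monoid.com_law idx) s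
    (G : 'I_N.+1 -> R) :
  \big[op/idx]_(v in cone s) G v =
    op (G ord0) (\big[op/idx]_(j in s) G (lift ord0 j)).
Proof.
rewrite big_setU1 ?ord0_lift_set // big_imset // => i j _ _.
exact: lift_inj.
Qed.

Lemma cone_D1_ord0 s : cone s :\ ord0 = lift_set s.
Proof. exact/setU1K/ord0_lift_set. Qed.

Lemma cone_D1_lift s j : cone s :\ lift ord0 j = cone (s :\ j).
Proof.
apply/setP => i; rewrite in_setD1; case: (unliftP ord0 i) => [i'|] ->.
  by rewrite !mem_cone in_setD1 (inj_eq (@lift_inj _ _)).
by rewrite !setU11 neq_lift.
Qed.

Lemma facets_Pi s : facets (Pi s) = [set cone s :\ v | v in cone s].
Proof.
apply/setP => F; rewrite inE; apply/maxsetP/imsetP => [|[v Cv ->]].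
  rewrite inE => -[proper_F max_F].
  have [sub_FC [v Cv F'v]] := properP proper_F.
  exists v => //; symmetry; apply: max_F; last by rewrite subsetD1 sub_FC.
  by rewrite inE properD1.
rewrite inE properD1 //; split=> // B; rewrite inE => /properP[sub_BC [w Cw B'w]].
move=> sub_B; apply/eqP; rewrite eqEsubset sub_B andbT subsetD1 sub_BC /=.
suff <-: w = v by [].
apply/eqP; apply: contraT => ne_wv; case/negP: B'w; apply: (subsetP sub_B).
by rewrite !inE ne_wv; move: Cw; rewrite !inE.
Qed.

Lemma cone_D1_facet s v : v \in cone s -> cone s :\ v \in facets (Pi s).
Proof. by move=> Cv; rewrite facets_Pi; apply/imsetP; exists v. Qed.

Lemma sum_facets_Pi (V : zmodType) s (G : {set 'I_N.+1} -> V) :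
  \sum_(F in facets (Pi s)) G F =
    G (lift_set s) + \sum_(j in s) G (cone (s :\ j)).
Proof.
rewrite facets_Pi big_imset /=; last exact: setD1_inj.
rewrite big_cone cone_D1_ord0; congr (_ + _); apply: eq_bigr => j _.
by rewrite cone_D1_lift.
Qed.

Lemma val_lift_ordering w : val (lift_ordering w) = [seq lift ord0 j | j <- w].
Proof. by rewrite /lift_ordering /= (map_comp _ (tnth w)) map_tnth_enum. Qed.

Lemma lift_ordering_of w s :
  ordering_of w s -> ordering_of (lift_ordering w) (lift_set s).
Proof.
case=> uniq_w set_w.
split; first by rewrite val_lift_ordering map_inj_uniq //; apply: lift_inj.
apply/setP => j; rewrite inE memtE val_lift_ordering; apply/mapP/imsetP => -[i].
  by move=> wi ->; exists i; rewrite // -set_w inE.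
by rewrite -set_w inE => wi ->; exists i.
Qed.

Lemma mem_lift_ordering w j : (lift ord0 j \in lift_ordering w) = (j \in w).
Proof.
apply/tnthP/tnthP => -[q].
  by rewrite tnth_mktuple => /lift_inj->; exists q.
by move=> ->; exists q; rewrite tnth_mktuple.
Qed.

Lemma simplex_mx_lift w :
  simplex_mx A (lift_ordering w) = simplex_mx (old_columns A) w.
Proof. by apply/matrixP => p q; rewrite !mxE tnth_mktuple. Qed.

(** This identifies a contribution to the mixed volume of Delta with one to the
    mixed volume of a sphere Pi, in the enlarged set of variables. *)
Lemma simplex_term_lift w f :
  simplex_term (old_columns A) w f = simplex_term A (lift_ordering w) (extend f).
Proof.
have form_lift j : phi_inv A (lift_ordering w) 'X_(lift ord0 j) =
                   phi_inv (old_columns A) w 'X_j.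
  rewrite /phi_inv !comp_mpolyXU -!tnth_nth !tnth_mktuple simplex_mx_lift.
  under eq_pick => q do rewrite tnth_mktuple (inj_eq (@lift_inj _ _)).
  by [].
rewrite /simplex_term; congr (FracField.tofrac _ / FracField.tofrac _).
  rewrite /local_poly /restrict /extend {1 2}/phi_inv !comp_mpolyA.
  congr (_ \mPo _); apply: eq_from_tnth => j; rewrite !tnth_mktuple.
  rewrite comp_mpolyXU -tnth_nth !tnth_mktuple !in_set mem_lift_ordering.
  by case: ifP => _; [exact: esym (form_lift j) | rewrite !comp_mpoly0].
rewrite /chi simplex_mx_lift /phi_inv; congr (_ *: _); rewrite !rmorph_prod.
by apply: eq_bigr => q _; rewrite tnth_mktuple; exact: esym (form_lift _).
Qed.

Lemma coneX0 w : coneX A w ord0 = \det (simplex_mx A (lift_ordering w)).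
Proof.
rewrite /coneX mul1r; congr (\det _); apply/matrixP => p q.
by rewrite !mxE liftK tnth_mktuple.
Qed.

(** Moving the column of the vertex q to the front costs the sign (-1)^q; when
    v_0 takes its place, the columns are those that define X_(q+1), whose sign
    is (-1)^(q+1). The list rest is the ordering w without its entry q. *)
Lemma coneX_lift w q :
  exists (rest : seq 'I_N.+1) (u u0 : n.-tuple 'I_N.+1),
  [/\ val u = lift ord0 (tnth w q) :: rest, val u0 = ord0 :: rest,
      perm_eq u (lift_ordering w),
      \det (simplex_mx A u) = (-1) ^+ q * \det (simplex_mx A (lift_ordering w))
    & coneX A w (lift ord0 q) = - ((-1) ^+ q * \det (simplex_mx A u0))].
Proof.
case: n A w q => [|n'] B w q; first by case: q.
pose g i := if unlift ord0 i is Some j then lift q j else q.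
have g_inj : injective g.
  move=> i i'; rewrite /g; case: unliftP => [j|] ->; case: unliftP => [j'|] -> //.
  - by move/lift_inj->.
  - by move/eqP; rewrite eq_sym (negPf (neq_lift _ _)).
  by move/eqP; rewrite (negPf (neq_lift _ _)).
pose u := [tuple tnth (lift_ordering w) (perm g_inj i) | i < n'.+1].
pose u0 := [tuple of ord0 :: behead_tuple u].
have u_0 : tnth u ord0 = lift ord0 (tnth w q).
  by rewrite tnth_mktuple permE /g unlift_none tnth_mktuple.
have u_S j : tnth u (lift ord0 j) = lift ord0 (tnth w (lift q j)).
  by rewrite tnth_mktuple permE /g liftK tnth_mktuple.
have u0_S j : tnth u0 (lift ord0 j) = tnth u (lift ord0 j).
  rewrite tnthS tnth_behead; congr (tnth u _); apply: val_inj.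
  by rewrite /= inordK ?ltnS.
exists (behead u), u, u0; split=> //.
- by rewrite -u_0; case: (u) => -[|? ?].
- by apply/tuple_permP; exists (perm g_inj).
- apply: det_move_col => [p|p j]; rewrite !mxE ?u_0 ?u_S tnth_mktuple //.
rewrite /coneX /= exprS -mulrA mulN1r; congr (- (_ * \det _)).
apply/matrixP => p j; rewrite !mxE; case: (unliftP ord0 j) => [i|] ->.
  rewrite u0_S u_S.
  have ->: lift (lift ord0 q) (lift ord0 i) = lift ord0 (lift q i).
    by apply: val_inj; rewrite /= /bump !add1n ltnS addnS.
  by rewrite liftK.
have ->: lift (lift ord0 q) ord0 = ord0 :> 'I_n'.+2 by apply: val_inj.
by rewrite unlift_none tnth0.
Qed.

(** The numbers X_0, ..., X_n, indexed by the vertices of the cone and extended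
    by 0. *)
Definition cone_weight w (v : 'I_N.+1) : K :=
  if unlift ord0 v is Some j then
    if [pick q | tnth w q == j] is Some q then coneX A w (lift ord0 q) else 0
  else coneX A w ord0.

Lemma cone_weight0 w : cone_weight w ord0 = coneX A w ord0.
Proof. by rewrite /cone_weight unlift_none. Qed.

Lemma cone_weight_lift w q : uniq w ->
  cone_weight w (lift ord0 (tnth w q)) = coneX A w (lift ord0 q).
Proof.
move=> uniq_w; rewrite /cone_weight liftK.
case: pickP => [q' /eqP/(tuple_uniqP _ uniq_w)-> //|/(_ q)].
by rewrite eqxx.
Qed.

Lemma cone_weight_out w s v : ordering_of w s -> v \notin cone s ->
  cone_weight w v = 0.
Proof.
case=> _ <-; case: (unliftP ord0 v) => [j|] ->; last by rewrite setU11.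
rewrite mem_cone inE /cone_weight liftK => w'j.
by case: pickP => // q /eqP e; rewrite -e mem_tnth in w'j.
Qed.

Lemma meval_cone_weight w f : (extend f).@[cone_weight w] = ev_Pi A w f.
Proof.
rewrite /extend comp_mpoly_meval; apply: eq_mmap => // j.
by rewrite tnth_mktuple mevalXU /cone_weight liftK.
Qed.

Lemma big_cone_ordering (R : Type) (idx : R) (op : Monoid.com_law idx) w s
    (G : 'I_N.+1 -> R) : ordering_of w s ->
  \big[op/idx]_(v in cone s) G v =
    op (G ord0) (\big[op/idx]_(q < n) G (lift ord0 (tnth w q))).
Proof.
case=> uniq_w set_w; rewrite big_cone.
rewrite -[in RHS](big_tuple _ _ _ predT (G \o lift ord0)).
by rewrite big_uniq //; congr (op _ _); apply: eq_bigl => j; rewrite -set_w inE.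
Qed.

Lemma cone_weight_kernel w s p : ordering_of w s ->
  \sum_v A p v * cone_weight w v = 0.
Proof.
move=> w_ord; have [uniq_w _] := w_ord.
rewrite (bigID (mem (cone s))) /= [X in _ + X]big1 => [|v C'v]; last first.
  by rewrite (cone_weight_out w_ord) ?mulr0.
rewrite addr0 (big_cone_ordering _ _ w_ord) cone_weight0.
rewrite -[RHS](signed_minors_kernel (cone_mx A w) p) big_ord_recl.
congr (_ * _ + _); first by rewrite mxE unlift_none.
by apply: eq_bigr => q _; rewrite cone_weight_lift // mxE liftK.
Qed.

Lemma prod_cone_weight w s : ordering_of w s ->
  \prod_(v in cone s) cone_weight w v = c_Pi A w.
Proof.
move=> w_ord; rewrite (big_cone_ordering _ _ w_ord) cone_weight0.
rewrite /c_Pi big_ord_recl; congr (_ * _); apply: eq_bigr => q _.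
by rewrite cone_weight_lift //; case: w_ord.
Qed.

Lemma extend_homog d f : f \is d.-homog -> extend f \is d.-homog.
Proof.
move=> /dhomogP f_homog; rewrite /extend comp_mpolyEX big_seq.
apply: rpred_sum => mu /f_homog <-; apply: dhomogZ.
rewrite comp_mpolyX /= mdegE; apply: (big_ind2 (fun p d => p \is d.-homog)).
- exact: dhomog1.
- by move=> p d1 q d2; apply: dhomogM.
move=> j _; rewrite tnth_mktuple.
have X_homog : 'X_(lift ord0 j) \is [in K[N.+1], 1.-homog].
  by rewrite dhomogX /= mdeg1.
by have := dhomogMn (mu j) X_homog; rewrite mul1n.
Qed.

End ConeBoundary.

(** * The mixed volume of the sphere over one facet *)

Section OrientedConeBoundary.
Variables (k K : fieldType) (n N : nat) (A : 'M[K]_(n, N.+1)).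
Variables (s : {set 'I_N}) (w : n.-tuple 'I_N).
Variable oPi : {set 'I_N.+1} -> n.-tuple 'I_N.+1.
Hypothesis char2 : 2%N \in [pchar k] -> 1 = -1 :> K.
Hypothesis A_gen : forall u : n.-tuple 'I_N.+1,
  uniq u -> \det (simplex_mx A u) != 0.
Hypothesis w_ord : ordering_of w s.
Hypothesis oPi_or : is_orientation k (Pi s) oPi.
Hypothesis oPi_w : same_orientation (lift_ordering w) (oPi (lift_set s)).

Lemma oPi_ord v : v \in cone s -> ordering_of (oPi (cone s :\ v)) (cone s :\ v).
Proof.
by move=> Cv; apply: (proj1 oPi_or); apply: cone_D1_facet.
Qed.

Lemma oPi_lift_ord : ordering_of (oPi (lift_set s)) (lift_set s).
Proof. by rewrite -cone_D1_ord0; apply: oPi_ord; rewrite setU11. Qed.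

(** This is opposite_det for the base of the cone and for the facet through v_0
    opposite to v. *)
Lemma oPi_det v rest (u u0 : n.-tuple 'I_N.+1) : v \in s ->
    val u = lift ord0 v :: rest -> val u0 = ord0 :: rest ->
    ordering_of u (lift_set s) ->
  \det (simplex_mx A (lift_ordering w)) * \det (simplex_mx A u0) =
    - (\det (simplex_mx A (oPi (cone (s :\ v)))) * \det (simplex_mx A u)).
Proof.
move=> sv def_u def_u0 u_ord.
have set_rest : [set x in rest] = lift_set (s :\ v).
  have [uniq_u set_u] := u_ord; rewrite def_u /= in uniq_u.
  apply/setP => x; rewrite inE; case: (unliftP ord0 x) => [j|] ->.
    rewrite mem_lift_set in_setD1 -[j \in s]mem_lift_set -set_u inE memtE def_u.
    rewrite inE (inj_eq (@lift_inj _ _)); case: eqP => [->|//] /=.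
    by apply/negbTE; case/andP: uniq_u.
  apply/idP/idP => [rest0|]; last by rewrite (negPf (ord0_lift_set _)).
  have := ord0_lift_set s; rewrite -set_u inE memtE def_u inE rest0.
  by rewrite orbT.
have F_ord : ordering_of (oPi (cone (s :\ v))) (cone (s :\ v)).
  by rewrite -cone_D1_lift; apply: oPi_ord; rewrite mem_cone.
have u0_ord : ordering_of u0 (cone (s :\ v)).
  split.
    rewrite def_u0 /=; have [uniq_u _] := u_ord; rewrite def_u /= in uniq_u.
    case/andP: uniq_u => _ ->; rewrite andbT.
    by have := ord0_lift_set (s :\ v); rewrite -set_rest inE.
  apply/setP => x; rewrite /cone -[in RHS]/(lift_set _) -set_rest !inE memtE.
  by rewrite def_u0 inE.
rewrite -(det_same_orientation A oPi_w).
apply: (opposite_det A oPi_lift_ord F_ord u_ord u0_ord def_u def_u0).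
have [/char2|or_opp] := proj2 oPi_or; first by left.
right; apply: or_opp.
- rewrite inE set_rest; apply/properP; split.
    apply/subsetP => x /imsetP[j]; rewrite in_setD1 => /andP[_ sj] ->.
    by rewrite mem_cone.
  by exists ord0; rewrite ?setU11 ?ord0_lift_set.
- have [uniq_u _] := u_ord; rewrite def_u /= in uniq_u.
  rewrite cardsE (card_uniqP _) ?(proj2 (andP uniq_u)) //.
  by rewrite -[RHS](size_tuple u) def_u.
- by rewrite -cone_D1_ord0 cone_D1_facet ?setU11.
- by rewrite -cone_D1_lift cone_D1_facet ?mem_cone.
- apply/eqP => /setP/(_ ord0).
  by rewrite (negPf (ord0_lift_set _)) setU11.
- by rewrite set_rest; apply/imsetS/subsetDl.
by rewrite set_rest; apply: subsetUr.
Qed.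

(** The sign (-1)^(q+1) in the definition of X_(q+1) is what the orientation
    requires: (-1)^q for bringing the vertex q to the front, and -1 because
    neighbouring facets induce opposite orientations. *)
Lemma det_oPi v : v \in cone s ->
  \det (simplex_mx A (oPi (cone s :\ v))) = cone_weight A w v.
Proof.
have [uniq_w set_w] := w_ord.
have lw_ord := lift_ordering_of w_ord.
case: (unliftP ord0 v) => [j|] -> => [|_]; last first.
  by rewrite cone_D1_ord0 cone_weight0 coneX0 (det_same_orientation A oPi_w).
rewrite mem_cone -set_w inE => /tnthP[q ->]; rewrite set_w.
rewrite cone_weight_lift // cone_D1_lift.
have [rest [u [u0 [def_u def_u0 perm_u det_u ->]]]] := coneX_lift A w q.
have u_ord : ordering_of u (lift_set s).
  have [uniq_lw set_lw] := lw_ord; split; first by rewrite (perm_uniq perm_u).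
  by rewrite -set_lw; apply/setP => x; rewrite !inE (perm_mem perm_u).
have s_q : tnth w q \in s by rewrite -set_w inE mem_tnth.
have := oPi_det s_q def_u def_u0 u_ord; rewrite det_u => opp.
have nz : (-1) ^+ q * \det (simplex_mx A (lift_ordering w)) != 0.
  by rewrite mulf_neq0 ?signr_eq0 // A_gen //; case: lw_ord.
(* The determinant of lift_ordering w cancels; (-1)^q is its own inverse. *)
apply: (mulIf nz); apply: oppr_inj; rewrite -opp !mulNr opprK.
by rewrite mulrACA -expr2 sqrr_sign mul1r mulrC.
Qed.

Lemma sum_Pi_terms f : f \is n.-homog ->
  \sum_(F in facets (Pi s)) simplex_term A (oPi F) f =
    FracField.tofrac ((f.@[cone_weight A w] / c_Pi A w)%:MP : {mpoly K[n]}).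
Proof.
move=> f_homog; rewrite facets_Pi big_imset /=; last exact: setD1_inj.
have C0 : ord0 \in cone s by rewrite setU11.
rewrite (sum_boundary_terms (X := cone_weight A w) _ _ _ _ _ C0) //.
- by rewrite (prod_cone_weight _ w_ord).
- exact: oPi_ord.
- exact: det_oPi.
- by move=> v Cv; rewrite -det_oPi // A_gen //; case: (oPi_ord Cv).
- by move=> v; apply: cone_weight_out.
by move=> p; apply: cone_weight_kernel w_ord.
Qed.

End OrientedConeBoundary.

(** * Cancellation of the facets through the apex *)

Lemma opposite_vertex (T : finType) (s t : {set T}) :
  #|t|.+1 = #|s| -> t \subset s -> exists2 v, v \in s & t = s :\ v.
Proof.
move=> card_t sub_ts.
have /cards1P[v def_v] : #|s :\: t| == 1%N.
  by rewrite -(eqn_add2l #|t|) addn1 card_t -{1}(setIidPr sub_ts) cardsID.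
have /andP[tv sv] : (v \notin t) && (v \in s) by rewrite -in_setD def_v set11.
exists v => //; apply/eqP; rewrite eqEcard subsetD1 sub_ts tv /=.
by rewrite -ltnS card_t [X in (_ < X)%N](cardsD1 v) sv.
Qed.

Lemma sum_subsets_D1 (T : finType) (V : zmodType) (s : {set T})
    (G : {set T} -> V) :
  \sum_(v in s) G (s :\ v) =
    \sum_(t : {set T} | (#|t|.+1 == #|s|) && (t \subset s)) G t.
Proof.
rewrite -(big_imset (h := fun v => s :\ v) G) /=; last exact: setD1_inj.
apply: eq_bigl => t; apply/imsetP/andP => [[v sv ->]|[/eqP card_t sub_ts]].
  by rewrite subsetDl [#|s|](cardsD1 v) sv eqxx.
by have [v] := opposite_vertex card_t sub_ts; exists v.
Qed.

Section Ridges.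
Variables (r n : nat) (D : {set {set 'I_r}}) (V : zmodType).

(** Exchange the sums: a codimension-one face t occurs for exactly two facets
    s. *)
Lemma sum_ridges_eq0 (T : {set 'I_r} -> {set 'I_r} -> V) :
    pseudo_manifold n D ->
    (forall t s s', t \in D -> #|t|.+1 = n -> s \in facets D ->
       s' \in facets D -> s != s' -> t \subset s -> t \subset s' ->
       T s t + T s' t = 0) ->
  \sum_(s in facets D) \sum_(v in s) T s (s :\ v) = 0.
Proof.
move=> [[_ _ sub_D] card_facet two_facets _] T_opp.
under eq_bigr => s Ds do rewrite sum_subsets_D1 card_facet //.
rewrite (exchange_big_dep (fun t : {set 'I_r} => #|t|.+1 == n)) /=; last first.
  by move=> s t _ /andP[].
apply: big1 => t /eqP card_t.
under eq_bigl => s do rewrite card_t eqxx /=.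
have [Dt|D't] := boolP (t \in D); last first.
  apply: big1 => s /andP[fs sub_ts]; case/negP: D't.
  by apply: sub_D sub_ts; move: fs; rewrite inE => /maxsetp.
have /eqP/cards2P[s [s' [ne_ss' def_ss']]] := two_facets t Dt card_t.
have mem_ss' i : (i \in facets D) && (t \subset i) = (i \in [set s; s']).
  by rewrite -def_ss' in_set.
have /andP[fs ts] : (s \in facets D) && (t \subset s) by rewrite mem_ss' set21.
have /andP[fs' ts'] : (s' \in facets D) && (t \subset s').
  by rewrite mem_ss' set22.
rewrite (eq_bigl _ _ mem_ss').
by rewrite big_setU1 ?inE //= big_set1; exact: (T_opp t s s').
Qed.

End Ridges.

Section SharedRidge.
Variables (k K : fieldType) (n N : nat) (A : 'M[K]_(n, N.+1)).
Variables (D : {set {set 'I_N}}) (o : {set 'I_N} -> n.-tuple 'I_N).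
Variable oPi : {set 'I_N} -> {set 'I_N.+1} -> n.-tuple 'I_N.+1.
Hypothesis char2 : 2%N \in [pchar k] -> 1 = -1 :> K.
Hypothesis A_gen : forall u : n.-tuple 'I_N.+1,
  uniq u -> \det (simplex_mx A u) != 0.
Hypothesis o_or : is_orientation k D o.
Hypothesis oPi_or : forall s, s \in facets D -> is_orientation k (Pi s) (oPi s).
Hypothesis oPi_o : forall s, s \in facets D ->
  same_orientation (lift_ordering (o s)) (oPi s (lift_set s)).

(** Three instances of opposite_det on the face t: between s and s' in D, and
    between the base and the facet cone t in each of the two spheres. *)
Lemma cone_ridge_cancel (t s s' : {set 'I_N}) f :
    t \in D -> #|t|.+1 = n -> s \in facets D -> s' \in facets D -> s != s' ->
    t \subset s -> t \subset s' -> #|s| = n -> #|s'| = n ->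
  simplex_term A (oPi s (cone t)) f + simplex_term A (oPi s' (cone t)) f = 0.
Proof.
move=> Dt card_t Ds Ds' ne_ss' ts ts' card_s card_s'.
have [o_ord o_opp] := o_or.
have front (x : {set 'I_N}) : #|x| = n -> t \subset x ->
    exists v (a : n.-tuple 'I_N),
      [/\ v \in x, t = x :\ v, val a = v :: enum t & ordering_of a x].
  move=> card_x tx; rewrite -card_x in card_t.
  have [v xv def_t] := opposite_vertex card_t tx; rewrite card_x in card_t.
  have size_a : size (v :: enum t) == n by rewrite /= -cardE card_t.
  exists v, (Tuple size_a); split=> //; split.
    by rewrite /= enum_uniq mem_enum def_t setD11.
  rewrite -(setD1K xv) -def_t.
  by apply/setP => i; rewrite inE memtE /= in_cons mem_enum in_setU1.
have [v [a [sv def_t def_a a_ord]]] := front s card_s ts.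
have [v' [a' [sv' def_t' def_a' a'_ord]]] := front s' card_s' ts'.
have size_u0 : size (ord0 :: [seq lift ord0 j | j <- enum t]) == n.
  by rewrite /= size_map -cardE card_t.
pose u0 := Tuple size_u0.
have lift_a : val (lift_ordering a) =
    lift ord0 v :: [seq lift ord0 j | j <- enum t].
  by rewrite val_lift_ordering def_a.
have lift_a' : val (lift_ordering a') =
    lift ord0 v' :: [seq lift ord0 j | j <- enum t].
  by rewrite val_lift_ordering def_a'.
have PiE := oPi_det A char2 (oPi_or Ds) (oPi_o Ds) sv lift_a
  (erefl : val u0 = _) (lift_ordering_of a_ord).
have PiE' := oPi_det A char2 (oPi_or Ds') (oPi_o Ds') sv' lift_a'
  (erefl : val u0 = _) (lift_ordering_of a'_ord).
rewrite -def_t in PiE; rewrite -def_t' in PiE'.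
have DE : \det (simplex_mx A (lift_ordering (o s))) *
            \det (simplex_mx A (lift_ordering a')) =
    - (\det (simplex_mx A (lift_ordering (o s'))) *
         \det (simplex_mx A (lift_ordering a))).
  rewrite !simplex_mx_lift; apply: (opposite_det _ (o_ord s Ds) (o_ord s' Ds')
    a_ord a'_ord def_a def_a').
  case: o_opp => [/char2|o_opp]; [by left | right].
  have -> : [set x in enum t] = t by apply/setP => i; rewrite inE mem_enum.
  exact: o_opp.
have a_neq0 : \det (simplex_mx A (lift_ordering a)) != 0.
  by apply: A_gen; case: (lift_ordering_of a_ord).
have a'_neq0 : \det (simplex_mx A (lift_ordering a')) != 0.
  by apply: A_gen; case: (lift_ordering_of a'_ord).
have F_ord := oPi_ord (oPi_or Ds) (v := lift ord0 v).
rewrite mem_cone cone_D1_lift -def_t in F_ord.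
have F_ord' := oPi_ord (oPi_or Ds') (v := lift ord0 v').
rewrite mem_cone cone_D1_lift -def_t' in F_ord'.
rewrite (simplex_term_sign (b := true) _ (F_ord sv) (F_ord' sv')).
- by rewrite mulN1r subrr.
- by rewrite unitmxE unitfE A_gen //; case: (F_ord sv).
rewrite mulN1r; apply: (mulIf a_neq0); apply: (mulIf a'_neq0).
rewrite !mulNr -mulNr -PiE mulrAC [in RHS]mulrAC DE.
by rewrite -[X in X * _]opprK -PiE' !mulNr mulrAC.
Qed.

End SharedRidge.

(** * Generic parameters *)

(** The determinant is 1 when the parameters are specialized so that the columns
    of u are those of the identity matrix. *)
Lemma det_param_mx_neq0 (k : fieldType) (n N : nat) (u : n.-tuple 'I_N.+1) :
  uniq u -> \det (simplex_mx (param_mx k n N) u) != 0.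
Proof.
move=> uniq_u.
pose M : 'M[{mpoly k[n * N.+1]}]_n :=
  \matrix_(p, q) 'X_(mxvec_index p (tnth u q)).
have ->: simplex_mx (param_mx k n N) u = map_mx (@FracField.tofrac _) M.
  by apply/matrixP => p q; rewrite !mxE.
rewrite det_map_mx tofrac_eq0.
pose d : 'M[k]_(n, N.+1) := \matrix_(p, j) (tnth u p == j)%:R.
pose ev : {rmorphism {mpoly k[n * N.+1]} -> k} :=
  meval (fun i => mxvec d ord0 i).
have ev_M : map_mx ev M = 1%:M.
  apply/matrixP => p q; rewrite !mxE /ev /= mevalXU mxvecE mxE.
  by rewrite (inj_eq (tuple_uniqP _ uniq_u)).
apply/eqP => det0; have := congr1 ev det0.
by rewrite -det_map_mx ev_M det1 rmorph0 => /eqP; rewrite oner_eq0.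
Qed.

Lemma param_field_char2 (k : fieldType) (n N : nat) :
  2%N \in [pchar k] -> 1 = -1 :> param_field k n N.
Proof.
move=> /pcharf0 two0; apply/eqP; rewrite -subr_eq0 opprK.
have := congr1 (fun c => FracField.tofrac (c%:MP : {mpoly k[n * N.+1]})) two0.
by rewrite /= !rmorph_nat mpolyC0 tofrac0 mulr2n => ->.
Qed.

(** * The main formula *)

Lemma mixed_volume_eq (K : fieldType) (n r : nat) (A : 'M[K]_(n, r)) D o f c :
    mixed_volume_frac A D o f = FracField.tofrac (c%:MP : {mpoly K[n]}) ->
  mixed_volume A D o f = c.
Proof.
move=> frac_c; rewrite /mixed_volume.
apply: classical_sets.xget_unique => // c'.
by rewrite frac_c => /eqP; rewrite tofrac_eq mpolyC_eq => /eqP.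
Qed.

(** The parameters enter only through the linear independence of any n distinct
    columns, so they need not be indeterminates. *)
Lemma ell_form_diagonal (k K : fieldType) (n N : nat) (A : 'M[K]_(n, N.+1))
    (D : {set {set 'I_N}}) (o : {set 'I_N} -> n.-tuple 'I_N)
    (oPi : {set 'I_N} -> {set 'I_N.+1} -> n.-tuple 'I_N.+1)
    (m : nat) (g : {mpoly K[N]}) :
    (2%N \in [pchar k] -> 1 = -1 :> K) ->
    (forall u : n.-tuple 'I_N.+1, uniq u -> \det (simplex_mx A u) != 0) ->
    pseudo_manifold n D -> is_orientation k D o ->
    (forall s, s \in facets D -> is_orientation k (Pi s) (oPi s)) ->
    (forall s, s \in facets D ->
       same_orientation (lift_ordering (o s)) (oPi s (lift_set s))) ->
    (2 * m <= n)%N -> g \is m.-homog ->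
  let f := ell K N ^+ (n - 2 * m) * g ^+ 2 in
  Q_ell A D o m g = \sum_(s in facets D) mixed_volume_Pi A s (oPi s) f
  /\ \sum_(s in facets D) mixed_volume_Pi A s (oPi s) f =
       \sum_(s in facets D)
         (c_Pi A (o s))^-1 * ev_Pi A (o s) (ell K N) ^+ (n - 2 * m)
                           * ev_Pi A (o s) g ^+ 2.
Proof.
move=> char2 A_gen D_pm o_or oPi_or oPi_o m_le g_homog.
pose l := ell K N; move=> f.
have [_ card_facet _ _] := D_pm; have [o_ord _] := o_or.
have f_homog : f \is n.-homog.
  have l_homog : l \is 1.-homog.
    by apply: rpred_sum => j _; rewrite dhomogX /= mdeg1.
  have := dhomogM (dhomogMn (n - 2 * m) l_homog) (dhomogMn 2 g_homog).
  by rewrite mul1n [(m * 2)%N]mulnC subnK.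
pose c s := ev_Pi A (o s) f / c_Pi A (o s).
have sum_Pi s : s \in facets D ->
    \sum_(F in facets (Pi s)) simplex_term A (oPi s F) (extend f) =
      FracField.tofrac ((c s)%:MP : {mpoly K[n]}).
  move=> Ds; rewrite (sum_Pi_terms char2 A_gen (o_ord s Ds) (oPi_or s Ds)) //.
  - by rewrite meval_cone_weight.
  - exact: oPi_o.
  exact: extend_homog.
have vol_Pi s : s \in facets D -> mixed_volume_Pi A s (oPi s) f = c s.
  move=> Ds; apply: mixed_volume_eq; rewrite -sum_Pi //.
  apply: eq_bigr => F PiF; apply: simplex_term_restrict => x.
  have [F_ord _] := oPi_or s Ds; have [_ set_F] := F_ord F PiF.
  move=> oFx; have : x \in F by rewrite -set_F inE.
  by apply: subsetP; move: PiF; rewrite inE => /maxsetp; rewrite inE => /proper_sub.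
split; last first.
  apply: eq_bigr => s Ds; rewrite vol_Pi // /c /f /ev_Pi rmorphM !rmorphXn /=.
  by rewrite mulrC mulrA.
rewrite (eq_bigr _ vol_Pi); apply: mixed_volume_eq.
rewrite !rmorph_sum; under [RHS]eq_bigr => s Ds.
  rewrite /= -sum_Pi // sum_facets_Pi; over.
rewrite big_split /= [X in _ + X](sum_ridges_eq0 D_pm (T := fun s t =>
  simplex_term A (oPi s (cone t)) (extend f))) ?addr0; last first.
  move=> t s s' Dt card_t Ds Ds' ne_ss' ts ts'.
  by rewrite (cone_ridge_cancel char2 A_gen o_or oPi_or oPi_o _ Dt) //;
    apply: card_facet.
apply: eq_bigr => s Ds; rewrite -/(simplex_term _ _ _) simplex_term_lift.
have lw_ord := lift_ordering_of (o_ord s Ds).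
symmetry; apply: (simplex_term_same_orientation _ lw_ord _ (oPi_o s Ds)).
by rewrite unitmxE unitfE A_gen //; case: lw_ord.
Qed.

Theorem theorem3p4 (k : fieldType) (n N : nat)
    (D : {set {set 'I_N}}) (o : {set 'I_N} -> n.-tuple 'I_N)
    (oPi : {set 'I_N} -> {set 'I_N.+1} -> n.-tuple 'I_N.+1)
    (m : nat) (g : {mpoly (param_field k n N)[N]})
    (D_pm : pseudo_manifold n D)
    (o_or : is_orientation k D o)
    (oPi_or : forall s, s \in facets D -> is_orientation k (Pi s) (oPi s))
    (oPi_o : forall s, s \in facets D ->
       same_orientation (lift_ordering (o s))
                        (oPi s [set lift ord0 j | j in s]))
    (m_le : (2 * m <= n)%N)
    (g_homog : g \is m.-homog) :
  let A := param_mx k n N in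
  let l := ell (param_field k n N) N in
  Q_ell A D o m g =
    \sum_(s in facets D)
       mixed_volume_Pi A s (oPi s) (l ^+ (n - 2 * m) * g ^+ 2)
  /\
  \sum_(s in facets D)
     mixed_volume_Pi A s (oPi s) (l ^+ (n - 2 * m) * g ^+ 2) =
    \sum_(s in facets D)
       (c_Pi A (o s))^-1 * ev_Pi A (o s) l ^+ (n - 2 * m)
                         * ev_Pi A (o s) g ^+ 2.
Proof.
move=> A l; apply: ell_form_diagonal D_pm o_or oPi_or oPi_o m_le g_homog.
- exact: param_field_char2.
exact: det_param_mx_neq0.
Qed.
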